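(* Let $\mathcal{Q}$ be a collection of finite initially connected initialized automata, and let $\mathcal{G}$ be the collection of finite simple groups that divide the monoid $M(\mathbf{Q})$ of some $(\mathbf{Q},q)\in\mathcal{Q}$. Then a Conway category satisfies the identities $\Gamma(\mathbf{Q},q)$ for all $(\mathbf{Q},q)\in\mathcal{Q}$ if and only if it satisfies the group identities $\Gamma(G)$ for all $G\in\mathcal{G}$.
   Context: Cartesian categories have chosen finite products (terminal object $T$, projections $\pi_i$, tupling $\langle\cdot\rangle$, $!_A:A\to T$, $f\times g$), strictly associative; composition is written $g\circ f$; $\Delta_{A^n}=\langle 1_A,\ldots,1_A\rangle:A\to A^n$. A dagger operation maps $f:A\times C\to A$ to $f^\dagger:C\to A$. A Conway category is a cartesian category with dagger satisfying: $(f\circ(1_A\times g))^\dagger=f^\dagger\circ g$ ($f:A\times B\to A$, $g:C\to B$); $f^{\dagger\dagger}=(f\circ(\Delta_{A^2}\times 1_C))^\dagger$ ($f:A\times A\times C\to A$); $(f\circ\langle g,\pi_2^{A\times C}\rangle)^\dagger=f\circ\langle (g\circ\langle f,\pi_2^{B\times C}\rangle)^\dagger,1_C\rangle$ ($f:B\times C\to A$, $g:A\times C\to B$). A finite automaton $\mathbf{Q}=(Q,Z,\cdot)$ has finite nonempty state set $Q$, finite nonempty input alphabet $Z$ and action $Q\times Z\to Q$, extended to words; $M(\mathbf{Q})$ is the monoid of functions $Q\to Q$, $q\mapsto qu$, induced by words $u\in Z^*$. Write $Q=\{q_1,\ldots,q_n\}$, identified with $\{1,\ldots,n\}$, and $Z=\{a_1,\ldots,a_m\}$.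 For an object $A$ and $i\in[n]$ let $\rho_i^{\mathbf{Q},A}=\langle\pi^{A^n}_{ia_1},\ldots,\pi^{A^n}_{ia_m}\rangle:A^n\to A^m$ ($ia_j$ is the index of $q_i\cdot a_j$). For $f:A^m\times C\to A$ let $f^{\mathbf{Q},A}:A^n\times C\to A^n$ have components $\pi_i^{A^n}\circ f^{\mathbf{Q},A}=f\circ(\rho_i^{\mathbf{Q},A}\times 1_C)$. The identity $\Gamma(\mathbf{Q})$ holds in $\mathcal{C}$ if $(f^{\mathbf{Q},A})^\dagger=\Delta_{A^n}\circ(f\circ(\Delta_{A^m}\times 1_C))^\dagger$ for all objects $A,C$ and all $f:A^m\times C\to A$. An initialized automaton $(\mathbf{Q},q_i)$ has a distinguished state; $\Gamma(\mathbf{Q},q_i)$ holds if $\pi_i^{A^n}\circ(f^{\mathbf{Q},A})^\dagger=(f\circ(\Delta_{A^m}\times 1_C))^\dagger$ for all such $A,C,f$. $(\mathbf{Q},q)$ is initially connected if every state equals $qu$ for some word $u$. For a finite group $G$, $\Gamma(G)$ is $\Gamma$ of the automaton $(G,G,\cdot)$ with action by multiplication. A group in a finite monoid $M$ is a subsemigroup which is a group; a finite group divides $M$ if it is a homomorphic image of a group in $M$. A finite group is simple if it is nontrivial and has no normal subgroups other than itself and the trivial one. *)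

(* Defs.v *)
From mathcomp Require Import all_boot all_fingroup.
From mathcomp Require Import gseries.

Set Implicit Arguments.
Unset Strict Implicit.
Unset Printing Implicit Defensive.

Record cartCat := CartCat {
  Obj :> Type;
  Hom : Obj -> Obj -> Type;
  idm : forall A, Hom A A;
  comp : forall A B C, Hom B C -> Hom A B -> Hom A C;
  comp_assoc : forall A B C D (h : Hom C D) (g : Hom B C) (f : Hom A B),
      comp h (comp g f) = comp (comp h g) f;
  comp_id_l : forall A B (f : Hom A B), comp (idm B) f = f;
  comp_id_r : forall A B (f : Hom A B), comp f (idm A) = f;
  Ter : Obj;
  bang : forall A, Hom A Ter;
  bang_uniq : forall A (f : Hom A Ter), f = bang A;
  prod : Obj -> Obj -> Obj;
  pi1 : forall A B, Hom (prod A B) A;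
  pi2 : forall A B, Hom (prod A B) B;
  pair : forall X A B, Hom X A -> Hom X B -> Hom X (prod A B);
  pi1_pair : forall X A B (f : Hom X A) (g : Hom X B), comp (pi1 A B) (pair f g) = f;
  pi2_pair : forall X A B (f : Hom X A) (g : Hom X B), comp (pi2 A B) (pair f g) = g;
  pair_uniq : forall X A B (h : Hom X (prod A B)),
      h = pair (comp (pi1 A B) h) (comp (pi2 A B) h)
}.

Arguments Hom {K} : rename.
Arguments idm {K} A : rename.
Arguments comp {K A B C} : rename.
Arguments Ter {K} : rename.
Arguments bang {K} A : rename.
Arguments prod {K} : rename.
Arguments pi1 {K} A B : rename.
Arguments pi2 {K} A B : rename.
Arguments pair {K X A B} : rename.

Section CartDefs.
Variable K : cartCat.

Definition pmap A B A' B' (f : @Hom K A A') (g : @Hom K B B') :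
    Hom (prod A B) (prod A' B') :=
  pair (comp f (pi1 A B)) (comp g (pi2 A B)).

(* powS A k = A^(k+1) = A x (A x ... x A), with A^1 = A. *)
Fixpoint powS (A : K) (k : nat) : K :=
  match k with 0 => A | S k' => prod A (powS A k') end.

Definition pw (A : K) (n : nat) : K :=
  match n with 0 => Ter | S k => powS A k end.

Fixpoint tupS (X A : K) (k : nat) : ('I_k.+1 -> Hom X A) -> Hom X (powS A k) :=
  match k return ('I_k.+1 -> Hom X A) -> Hom X (powS A k) with
  | 0 => fun fs => fs ord0
  | S k' => fun fs => pair (fs ord0) (@tupS X A k' (fun i => fs (lift ord0 i)))
  end.

Definition tup (X A : K) (n : nat) : ('I_n -> Hom X A) -> Hom X (pw A n) :=
  match n return ('I_n -> Hom X A) -> Hom X (pw A n) with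
  | 0 => fun _ => bang X
  | S k => @tupS X A k
  end.

Fixpoint projS (A : K) (k : nat) : 'I_k.+1 -> Hom (powS A k) A :=
  match k return 'I_k.+1 -> Hom (powS A k) A with
  | 0 => fun _ => idm A
  | S k' => fun i => match unlift ord0 i with
                     | None => pi1 A (powS A k')
                     | Some j => comp (@projS A k' j) (pi2 A (powS A k'))
                     end
  end.

Definition ord0_absurd (i : 'I_0) : False :=
  (fun e : false = true => match e in _ = b return (if b then False else True) with erefl => I end) (ltn_ord i).

Definition proj (A : K) (n : nat) : 'I_n -> Hom (pw A n) A :=
  match n return 'I_n -> Hom (pw A n) A with
  | 0 => fun i => False_rect _ (ord0_absurd i)
  | S k => @projS A k
  end.

Definition diag (A : K) (n : nat) : Hom A (pw A n) := @tup A A n (fun _ => idm A).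

End CartDefs.

Arguments pmap {K A B A' B'}.
Arguments pw {K}.
Arguments tup {K X A n}.
Arguments proj {K A n}.
Arguments diag {K}.

Definition daggerOp (K : cartCat) :=
  forall (A C : K), Hom (prod A C) A -> Hom C A.

Definition conway (K : cartCat) (dag : daggerOp K) : Prop :=
  (forall (A B C : K) (f : Hom (prod A B) A) (g : Hom C B),
      dag A C (comp f (pmap (idm A) g)) = comp (dag A B f) g) /\
  (* double dagger identity: f : A x A x C -> A; here Delta_{A^2} x 1_C :
     A x C -> A x (A x C) is <pi1, <pi1, pi2>> *)
  (forall (A C : K) (f : Hom (prod A (prod A C)) A),
      dag A C (dag A (prod A C) f)
      = dag A C (comp f (pair (pi1 A C) (pair (pi1 A C) (pi2 A C))))) /\
  (forall (A B C : K) (f : Hom (prod B C) A) (g : Hom (prod A C) B),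
      dag A C (comp f (pair g (pi2 A C)))
      = comp f (pair (dag B C (comp g (pair f (pi2 B C)))) (idm C))).

Record automaton := Automaton {
  st : finType;
  al : finType;
  act : st -> al -> st;
  st_nonempty : 0 < #|st|;
  al_nonempty : 0 < #|al|
}.

Definition actw (Q : automaton) (q : st Q) (u : seq (al Q)) : st Q :=
  foldl (@act Q) q u.

Definition init_automaton := { Q : automaton & st Q }.

Definition initially_connected (Qq : init_automaton) : Prop :=
  forall q' : st (projT1 Qq), exists u : seq (al (projT1 Qq)),
    q' = actw (projT2 Qq) u.

(* The monoid M(Q): maps q |-> qu induced by words u; product of the maps
   of u and v is the map of uv, i.e. first u then v. *)
Definition inM (Q : automaton) (f : {ffun st Q -> st Q}) : Prop :=
  exists u : seq (al Q), forall q, f q = actw q u.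

Definition Mmul (Q : automaton) (f g : {ffun st Q -> st Q}) : {ffun st Q -> st Q} :=
  [ffun q => g (f q)].

(* A finite group G divides M(Q): G is a homomorphic image of a group in
   M(Q), i.e. of a subsemigroup H of M(Q) which is a group (with its own
   identity e). *)
Definition divides_monoid (G : finGroupType) (Q : automaton) : Prop :=
  exists (H : {set {ffun st Q -> st Q}}) (e : {ffun st Q -> st Q}),
    [/\ (forall h, h \in H -> inM h),
        (forall x y, x \in H -> y \in H -> Mmul x y \in H) /\ e \in H,
        (forall x, x \in H -> Mmul e x = x /\ Mmul x e = x),
        (forall x, x \in H -> exists2 y, y \in H & Mmul x y = e /\ Mmul y x = e) &
        exists phi : {ffun st Q -> st Q} -> G,
          (forall x y, x \in H -> y \in H -> phi (Mmul x y) = (phi x * phi y)%g) /\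
          (forall g : G, exists2 x, x \in H & phi x = g)].

Section Gamma.
Variables (K : cartCat) (dag : daggerOp K) (Q : automaton).

(* states and letters identified with 'I_n and 'I_m via enumeration *)
Local Notation n := #|st Q|.
Local Notation m := #|al Q|.

Definition rho (A : K) (i : 'I_n) : Hom (pw A n) (pw A m) :=
  tup (fun j : 'I_m => proj (enum_rank (act (enum_val i) (enum_val j)))).

Definition fQ (A C : K) (f : Hom (prod (pw A m) C) A) :
    Hom (prod (pw A n) C) (pw A n) :=
  tup (fun i : 'I_n => comp f (pmap (rho A i) (idm C))).

Definition Gamma : Prop :=
  forall (A C : K) (f : Hom (prod (pw A m) C) A),
    @dag (pw A n) C (fQ f)
    = comp (diag A n) (@dag A C (comp f (pmap (diag A m) (idm C)))).

Definition Gamma_init (q : st Q) : Prop :=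
  forall (A C : K) (f : Hom (prod (pw A m) C) A),
    comp (proj (enum_rank q)) (@dag (pw A n) C (fQ f))
    = @dag A C (comp f (pmap (diag A m) (idm C))).

End Gamma.

Lemma group_card_gt0 (G : finGroupType) : 0 < #|G|.
Proof. by apply/card_gt0P; exists 1%g. Qed.

Definition group_automaton (G : finGroupType) : automaton :=
  @Automaton G G (fun x y => (x * y)%g) (group_card_gt0 G) (group_card_gt0 G).

Definition Gamma_group (K : cartCat) (dag : daggerOp K) (G : finGroupType) : Prop :=
  Gamma dag (group_automaton G).

(* Main.v *)
From mathcomp Require Import all_boot all_fingroup gseries.
Require Import Defs.

Set Implicit Arguments.
Unset Strict Implicit.
Unset Printing Implicit Defensive.

(* Applied to the objects A^P, the identity Gamma(Q, q) says that a system of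
   fixed point equations x_(q,p) = G_p(x_(qz,p')) has solutions independent
   of q. In this form the identities pass to subautomata, quotients, cascade
   products, successor states, and alphabets of nonempty words, by solving
   subsystems separately. Hence Gamma(Q, q) gives Gamma(G) for every
   nontrivial G dividing M(Q).

   Conversely, if some letter c of Q is not a permutation, the double dagger
   identity separates the occurrences of c from the other letters B: Gamma of
   the monoid generated by B solves the B-part, and what is left is a system
   over the smaller state set Qc. This replaces the Krohn-Rhodes decomposition;
   the induction ends at permutation automata, hence at groups, which are
   reduced to their composition factors by cascade products. *)

(** * Powers indexed by finite types, and renaming of variables *)

Section Cartesian.
Variable K : cartCat.
Implicit Types A B C X : K.

Lemma compA A B C D (h : @Hom K C D) (g : Hom B C) (f : Hom A B) :
  comp (comp h g) f = comp h (comp g f).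
Proof. by rewrite comp_assoc. Qed.

Lemma comp_pair X Y A B (f : @Hom K X A) (g : Hom X B) (h : Hom Y X) :
  comp (pair f g) h = pair (comp f h) (comp g h).
Proof. by rewrite [LHS]pair_uniq !comp_assoc pi1_pair pi2_pair. Qed.

Lemma pair_pi A B : pair (pi1 A B) (pi2 A B) = idm (prod A B).
Proof. by rewrite [RHS]pair_uniq !comp_id_r. Qed.

(** Tests equations on generalized elements; the pair of projections is the generic one. *)
Lemma hom_prod_ext A B C (f g : Hom (prod A B) C) :
  (forall X (a : Hom X A) (b : Hom X B), comp f (pair a b) = comp g (pair a b)) ->
  f = g.
Proof. by move/(_ _ (pi1 A B) (pi2 A B)); rewrite pair_pi !comp_id_r. Qed.

Lemma eq_tupS X A k (fs gs : 'I_k.+1 -> Hom X A) :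
  fs =1 gs -> tupS fs = tupS gs.
Proof.
elim: k fs gs => [|k IH] fs gs e /=; first exact: e.
by rewrite e; congr pair; apply: IH => i.
Qed.

Lemma projS_tupS X A k (fs : 'I_k.+1 -> Hom X A) i :
  comp (projS A i) (tupS fs) = fs i.
Proof.
elim: k fs i => [|k IH] fs i /=; first by rewrite comp_id_l (ord1 i).
by case: unliftP => [j|] ->; rewrite ?compA ?pi1_pair // pi2_pair IH.
Qed.

Lemma tupS_proj X A k (h : Hom X (powS A k)) :
  h = tupS (fun i => comp (projS A i) h).
Proof.
elim: k h => [|k IH] h /=; first by rewrite comp_id_l.
rewrite [LHS]pair_uniq [comp (pi2 _ _) h in LHS]IH unlift_none.
by congr pair; apply: eq_tupS => i; rewrite liftK compA.
Qed.

(** Indexing by finite types allows products and sums of index sets without arithmetic; the powers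
    in [Gamma] are of this form by conversion. *)
Definition fpow (I : finType) A : K := pw A #|I|.

Definition ftup (I : finType) X A (fs : I -> Hom X A) : Hom X (fpow I A) :=
  tup (fun i => fs (enum_val i)).

Definition fproj (I : finType) A (i : I) : Hom (fpow I A) A :=
  proj (enum_rank i).

Lemma eq_tup n X A (fs gs : 'I_n -> Hom X A) : fs =1 gs -> tup fs = tup gs.
Proof. by case: n fs gs => [//|n] fs gs; apply: eq_tupS. Qed.

Lemma proj_tup n X A (fs : 'I_n -> Hom X A) i : comp (proj i) (tup fs) = fs i.
Proof. by case: n fs i => [fs [] //|n] fs i; apply: projS_tupS. Qed.

Lemma tup_proj n X A (h : Hom X (pw A n)) : h = tup (fun i => comp (proj i) h).
Proof. by case: n h => [|n] h; [rewrite [h]bang_uniq | apply: tupS_proj]. Qed.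

Section Families.
Variable I : finType.

Lemma eq_ftup X A (fs gs : I -> Hom X A) : fs =1 gs -> ftup fs = ftup gs.
Proof. by move=> e; apply: eq_tup. Qed.

Lemma fproj_ftup X A (fs : I -> Hom X A) i : comp (fproj A i) (ftup fs) = fs i.
Proof. by rewrite /fproj /ftup proj_tup enum_rankK. Qed.

Lemma ftup_fproj X A (h : Hom X (fpow I A)) :
  ftup (fun i => comp (fproj A i) h) = h.
Proof.
by rewrite [RHS]tup_proj; apply: eq_tup => i; rewrite /fproj enum_valK.
Qed.

Lemma fpow_ext X A (f g : Hom X (fpow I A)) :
  (forall i, comp (fproj A i) f = comp (fproj A i) g) -> f = g.
Proof. by move=> e; rewrite -[f]ftup_fproj -[g]ftup_fproj; apply: eq_ftup. Qed.

Lemma comp_ftup X Y A (fs : I -> Hom X A) (h : Hom Y X) :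
  comp (ftup fs) h = ftup (fun i => comp (fs i) h).
Proof. by apply: fpow_ext => i; rewrite -compA !fproj_ftup. Qed.

Lemma fpow_prod_ext A B C (f g : Hom (prod (fpow I A) C) B) :
  (forall X (v : I -> Hom X A) (c : Hom X C),
     comp f (pair (ftup v) c) = comp g (pair (ftup v) c)) ->
  f = g.
Proof.
by move=> e; apply: hom_prod_ext => X a b; rewrite -[a]ftup_fproj.
Qed.

End Families.

Lemma comp_pmap X A B A' B' (f : @Hom K A A') (g : Hom B B')
    (a : Hom X A) (b : Hom X B) :
  comp (pmap f g) (pair a b) = pair (comp f a) (comp g b).
Proof. by rewrite /pmap comp_pair !compA pi1_pair pi2_pair. Qed.

Definition catE := (compA, comp_pmap, comp_pair, comp_ftup, pi1_pair, pi2_pair,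
  fproj_ftup, comp_id_l, comp_id_r).

Fact rename_key : unit. Proof. exact: tt. Qed.

(* Substitutes the variable [s j] for the variable [j]. Locked, like [sol]
   below, so that rewriting with [catE] does not look through it. *)
Definition rename (I J : finType) (s : J -> I) A C :
    Hom (prod (fpow I A) C) (prod (fpow J A) C) :=
  locked_with rename_key (pmap (ftup (fun j => fproj A (s j))) (idm C)).

Lemma renameE (I J : finType) (s : J -> I) A C :
  rename s A C = pmap (ftup (fun j => fproj A (s j))) (idm C).
Proof. by rewrite /rename unlock. Qed.

Lemma rename_pair (I J : finType) (s : J -> I) X A C
    (v : I -> Hom X A) (c : Hom X C) :
  comp (rename s A C) (pair (ftup v) c) = pair (ftup (fun j => v (s j))) c.
Proof.
rewrite renameE !catE; congr pair; apply: eq_ftup => j.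
by rewrite !catE.
Qed.

Definition sysE := (rename_pair, catE).

Lemma rename_comp (I J L : finType) (s : J -> I) (t : L -> J) A C :
  comp (rename t A C) (rename s A C) = rename (fun l => s (t l)) A C.
Proof. by apply: fpow_prod_ext => X v c; rewrite compA !rename_pair. Qed.

Lemma eq_rename (I J : finType) (s t : J -> I) A C :
  s =1 t -> rename s A C = rename t A C.
Proof.
move=> e; apply: fpow_prod_ext => X v c; rewrite !rename_pair.
by congr pair; apply: eq_ftup => j; rewrite e.
Qed.

End Cartesian.

Arguments fpow {K} I A.
Arguments ftup {K I X A}.
Arguments fproj {K I A}.
Arguments rename {K I J} s A C.

(** * Systems of fixed point equations in a Conway category *)

Section Conway.
Variables (K : cartCat) (dag : daggerOp K) (HK : conway dag).
Implicit Types A B C E : K.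

Local Notation dg := (@dag _ _).

Lemma dag_param A B C (f : Hom (prod A B) A) (g : Hom C B) :
  dg (comp f (pmap (idm A) g)) = comp (dg f) g.
Proof. by case: HK => + _; apply. Qed.

Lemma dag_double A C (f : Hom (prod A (prod A C)) A) :
  dg (dg f) = dg (comp f (pair (pi1 A C) (pair (pi1 A C) (pi2 A C)))).
Proof. by case: HK => _ [+ _]; apply. Qed.

Lemma dag_comp A B C (f : Hom (prod B C) A) (g : Hom (prod A C) B) :
  dg (comp f (pair g (pi2 A C)))
  = comp f (pair (dg (comp g (pair f (pi2 B C)))) (idm C)).
Proof. by case: HK => _ [_]; apply. Qed.

Lemma dag_fix A C (f : Hom (prod A C) A) : dg f = comp f (pair (dg f) (idm C)).
Proof.
have := dag_comp f (pi1 A C).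
by rewrite pair_pi comp_id_r pi1_pair.
Qed.

(* [s] reads and [m] overwrites a part [B] of [E]. If that part evolves
   autonomously under [f], it can be solved first: [f] is the diagonal of
   [F (s e1) (e2, c)], whose inner dagger is computed by [dag_comp]. *)
Lemma dag_lens E B C (s : Hom E B) (m : Hom (prod B E) E)
    (f : Hom (prod E C) E) (f' : Hom (prod B C) B) :
  comp s m = pi1 B E -> comp m (pair s (idm E)) = idm E ->
  comp s f = comp f' (pmap s (idm C)) ->
  comp s (dg f) = dg f'.
Proof.
move=> sm ms sf.
pose F : Hom (prod B (prod E C)) E :=
  comp m (pair (comp f' (pair (pi1 _ _) (comp (pi2 _ _) (pi2 _ _))))
               (comp f (pi2 _ _))).
pose k : Hom (prod E (prod E C)) E := comp F (pair (comp s (pi1 _ _)) (pi2 _ _)).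
(* The value written, [f' (s e, c)], is by [sf] already the [s]-part of [f (e, c)], so by [ms] the
   overwriting changes nothing. *)
have kd : comp k (pair (pi1 E C) (pair (pi1 E C) (pi2 E C))) = f.
  apply: hom_prod_ext => X e c; rewrite /k /F !catE.
  have := congr1 (fun h => comp h (pair e c)) sf; rewrite /= !catE => <-.
  have := congr1 (fun h => comp h (comp f (pair e c))) ms.
  by rewrite /= !catE.
have sk : comp s (dg k) = comp (dg f') (pi2 E C).
  (* The dagger moves from [E] to [B], where [sm] leaves only [f'], independent of the outer copy of
     [E]. *)
  rewrite /k dag_comp.
  have -> : comp (comp s (pi1 E (prod E C))) (pair F (pi2 B (prod E C)))
            = comp f' (pmap (idm B) (pi2 E C)).
    by rewrite /F !catE -compA sm !catE /pmap comp_id_l.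
  rewrite dag_param /F -compA -(compA s) sm.
  rewrite !catE -{2}(comp_id_l (pi2 E C)) -comp_pair.
  by rewrite -compA -dag_fix.
rewrite -kd -dag_double dag_fix -compA sk.
by rewrite !catE.
Qed.

Fact sol_key : unit. Proof. exact: tt. Qed.

Section Sol.
Variable I : finType.

Definition sol A C (F : I -> Hom (prod (fpow I A) C) A) (i : I) : Hom C A :=
  locked_with sol_key (comp (fproj i) (dg (ftup F))).

Lemma solE A C (F : I -> Hom (prod (fpow I A) C) A) i :
  sol F i = comp (fproj i) (dg (ftup F)).
Proof. by rewrite /sol unlock. Qed.

Lemma ftup_sol A C (F : I -> Hom (prod (fpow I A) C) A) :
  ftup (sol F) = dg (ftup F).
Proof. by rewrite -[RHS]ftup_fproj; apply: eq_ftup => i; rewrite solE. Qed.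

Lemma eq_sol A C (F F' : I -> Hom (prod (fpow I A) C) A) :
  F =1 F' -> sol F =1 sol F'.
Proof. by move=> e i; rewrite !solE (eq_ftup e). Qed.

Lemma sol_fix A C (F : I -> Hom (prod (fpow I A) C) A) i :
  sol F i = comp (F i) (pair (ftup (sol F)) (idm C)).
Proof. by rewrite ftup_sol solE {1}dag_fix -compA fproj_ftup. Qed.

Lemma sol_param A B C (F : I -> Hom (prod (fpow I A) B) A) (g : Hom C B) i :
  sol (fun i => comp (F i) (pmap (idm _) g)) i = comp (sol F i) g.
Proof. by rewrite !solE -comp_ftup dag_param compA. Qed.

Lemma sol_double A C
    (F : I -> Hom (prod (fpow I A) (prod (fpow I A) C)) A) :
  sol (sol F) =1
  sol (fun i => comp (F i) (pair (pi1 _ _) (pair (pi1 _ _) (pi2 _ _)))).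
Proof. by move=> i; rewrite !solE ftup_sol dag_double comp_ftup. Qed.

End Sol.

(** The equations of the variables in the image of [s] mention only such variables, so this closed
    subsystem can be solved alone by [dag_lens]. *)
Lemma sol_sub (I J : finType) (s : J -> I) A C
    (F : I -> Hom (prod (fpow I A) C) A) (F' : J -> Hom (prod (fpow J A) C) A) j :
  injective s -> (forall j, F (s j) = comp (F' j) (rename s A C)) ->
  sol F (s j) = sol F' j.
Proof.
move=> s_inj FF'.
pose m : Hom (prod (fpow J A) (fpow I A)) (fpow I A) :=
  ftup (fun i => if [pick j | s j == i] is Some j then comp (fproj j) (pi1 _ _)
                 else comp (fproj i) (pi2 _ _)).
have ms X (u : J -> Hom X A) v i :
    comp (fproj i) (comp m (pair (ftup u) (ftup v)))
    = if [pick j | s j == i] is Some j then u j else v i.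
  by rewrite /m !catE; case: pickP => [j' _|_]; rewrite !catE.
have := @dag_lens (fpow I A) (fpow J A) C (ftup (fun j => fproj (s j))) m
  (ftup F) (ftup F').
move=> H; rewrite !solE -H.
- by rewrite -compA fproj_ftup.
- apply: fpow_prod_ext => X v e; rewrite -[e]ftup_fproj.
  apply: fpow_ext => j'; rewrite -!compA fproj_ftup compA ms !catE.
  case: pickP => [j'' /eqP/s_inj -> //|/(_ j')]; by rewrite eqxx.
- apply: fpow_ext => i; rewrite -{1}(ftup_fproj (idm (fpow I A))) ms.
  by case: pickP => [j' /eqP <- //|_]; rewrite !comp_id_r.
- apply: fpow_ext => j'.
  by rewrite -!compA !fproj_ftup FF' renameE.
Qed.

(* Solving first for the equations [x_i = x_(r i)]. *)
Lemma sol_unfold (I : finType) A C (F : I -> Hom (prod (fpow I A) C) A)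
    (r : I -> I) :
  (forall i, r (r i) = r i) ->
  (forall i, r i != i -> F i = comp (fproj (r i)) (pi1 _ _)) ->
  sol F =1 sol (fun i => comp (F i) (rename r A C)).
Proof.
move=> rr Fr i0.
(* Occurrences of variables moved by [r] are inner, all others outer; the inner dagger replaces each
   moved [j] by the outer [r j]. *)
pose D i : Hom (prod (fpow I A) (prod (fpow I A) C)) A :=
  if r i != i then comp (fproj (r i)) (comp (pi1 _ _) (pi2 _ _)) else
  comp (F i) (pair (ftup (fun j => if r j != j then comp (fproj j) (pi1 _ _)
                                   else comp (fproj j) (comp (pi1 _ _) (pi2 _ _))))
                   (comp (pi2 _ _) (pi2 _ _))).
transitivity (sol (sol D) i0).
  rewrite sol_double; apply: eq_sol => i; rewrite /D.
  apply: fpow_prod_ext => X v c; case: ifP => [/Fr -> | _]; rewrite !catE //.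
  by congr (comp _ (pair _ _)); apply: eq_ftup => j; case: ifP; rewrite !catE.
have De i : r i != i -> sol D i = comp (fproj (r i)) (pi1 _ _).
  by move=> ri; rewrite sol_fix /D ri !catE.
apply: eq_sol => i; have [ri|ri] := boolP (r i != i).
  rewrite De // (Fr _ ri); apply: fpow_prod_ext => X v c.
  by rewrite !compA rename_pair !catE rr.
rewrite sol_fix {1}/D (negPf ri); apply: fpow_prod_ext => X v c.
rewrite !compA rename_pair !catE.
congr (comp _ (pair _ _)); apply: eq_ftup => j; case: ifP => rj.
  by rewrite !catE De // !catE.
by rewrite !catE (eqP (negbFE rj)).
Qed.

End Conway.

Arguments eq_sol {K dag I A C F F'}.

(** * Closure properties of the automaton identities *)

Section Identities.
Variables (K : cartCat) (dag : daggerOp K) (HK : conway dag).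
Implicit Types A C : K.

Definition step (Q Z : finType) (d : Q -> Z -> Q) (P : finType) (qp : Q * P)
    (zp : Z * P) : Q * P := (d qp.1 zp.1, zp.2).

(* [Gamma_init] for the objects [A^P], flattened: the system
   [x_(q,p) = G_p (x_(qz,p') : (z,p') in Z * P)] has the [q]-independent
   solution of [x_p = G_p (x_p' : (z,p') in Z * P)]. *)
Definition gam (Q Z : finType) (d : Q -> Z -> Q) (q : Q) : Prop :=
  forall A C (P : finType) (G : P -> Hom (prod (fpow (Z * P)%type A) C) A) p,
    sol dag (fun qp => comp (G qp.2) (rename (step d qp) A C)) (q, p)
    = sol dag (fun p => comp (G p) (rename snd A C)) p.

(** The family [G] is bundled into one morphism [f] on the object [A^P]; the powers [(A^P)^Q] and
    [A^(Q * P)] are then identified by [dag_lens]. *)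
Lemma Gamma_init_gam (Q : automaton) (q : st Q) :
  Gamma_init dag q -> gam (@act Q) q.
Proof.
move=> H A C P G p.
pose f : Hom (prod (pw (fpow P A) #|al Q|) C) (fpow P A) :=
  ftup (fun p => comp (G p)
    (pmap (ftup (fun zp : al Q * P => comp (fproj zp.2) (@fproj K (al Q) _ zp.1)))
          (idm C))).
have fE X (a : al Q -> Hom X (fpow P A)) (c : Hom X C) p' :
    comp (fproj p') (comp f (pair (ftup a) c)) =
    comp (G p') (pair (ftup (fun zp : al Q * P => comp (fproj zp.2) (a zp.1))) c).
  rewrite /f !catE; congr (comp _ (pair _ _)); apply: eq_ftup => zp.
  by rewrite !catE.
move: f fE => f fE; have := H (fpow P A) C f.
have -> : comp f (pmap (diag (fpow P A) #|al Q|) (idm C))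
          = ftup (fun p => comp (G p) (rename snd A C)).
  apply: fpow_prod_ext => X v c; apply: fpow_ext => p'.
  have dE : comp (diag (fpow P A) #|al Q|) (ftup v) = ftup (fun _ => ftup v).
    rewrite -[LHS]ftup_fproj; apply: eq_ftup => z.
    by rewrite /diag /fproj -compA proj_tup comp_id_l.
  rewrite compA comp_pmap comp_id_l dE fE !sysE.
  by congr (comp _ (pair _ _)); apply: eq_ftup => zp; rewrite !catE.
move=> e; rewrite !solE -{}e -compA.
pose s : Hom (fpow (st Q) (fpow P A)) (fpow (st Q * P)%type A) :=
  ftup (fun qp => comp (fproj qp.2) (fproj qp.1)).
pose m : Hom (prod (fpow (st Q * P)%type A) (fpow (st Q) (fpow P A)))
             (fpow (st Q) (fpow P A)) :=
  ftup (fun q => ftup (fun p => comp (fproj (q, p)) (pi1 _ _))).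
have sE : comp (fproj p) (@fproj K (st Q) _ q) = comp (fproj (q, p)) s.
  by rewrite /s !catE.
rewrite -/(fproj q) sE compA.
rewrite (dag_lens HK (m := m) (f' :=
  ftup (fun qp : st Q * P => comp (G qp.2) (rename (step (@act Q) qp) A C)))) //.
- by apply: fpow_ext => -[q' p']; rewrite /s /m !catE.
- apply: fpow_ext => q'; apply: fpow_ext => p'.
  by rewrite /s /m !catE.
- apply: fpow_prod_ext => X v c; apply: fpow_ext => -[q' p'].
  rewrite {1}/s -!compA !fproj_ftup !compA.
  have -> : comp (fproj q') (comp (fQ f) (pair (ftup v) c))
          = comp f (pair (ftup (fun z => v (act q' z))) c).
    rewrite -compA -[fQ f]/(ftup (fun q => comp f
      (pmap (ftup (fun z => fproj (act q z))) (idm C)))) fproj_ftup compA.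
    rewrite comp_pmap !catE; congr (comp _ (pair _ _)).
    by apply: eq_ftup => z; rewrite !catE.
  have -> : comp (pmap s (idm C)) (pair (ftup v) c)
          = pair (ftup (fun qp : st Q * P => comp (fproj qp.2) (v qp.1))) c.
    rewrite /s !catE; congr pair; apply: eq_ftup => qp.
    by rewrite !catE.
  by rewrite fE rename_pair.
Qed.

Lemma gam_Gamma_init (Q : automaton) (q : st Q) :
  gam (@act Q) q -> Gamma_init dag q.
Proof.
move=> H A C f.
pose G (_ : unit) : Hom (prod (fpow (al Q * unit)%type A) C) A :=
  comp f (pmap (ftup (fun z => fproj (z, tt))) (idm C)).
have GE X (v : al Q * unit -> Hom X A) (c : Hom X C) :
    comp (G tt) (pair (ftup v) c) = comp f (pair (ftup (fun z => v (z, tt))) c).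
  rewrite /G !catE; congr (comp _ (pair _ _)); apply: eq_ftup => z.
  by rewrite !catE.
move: G GE => G GE; have e := H A C _ G tt.
have <- : sol dag (fun q => comp f (rename (act q) A C)) q
          = comp (proj (enum_rank q)) (dag (fQ f)).
  rewrite solE; congr (comp _ (dag _)).
  by apply: eq_tup => j; rewrite renameE.
rewrite -(sol_sub HK (s := fun q => (q, tt)) (F := fun qp : st Q * unit =>
  comp (G qp.2) (rename (step (@act Q) qp) A C))); first last.
- move=> q'; apply: fpow_prod_ext => X v c.
  by rewrite !compA !rename_pair /= GE.
- by move=> ? ? [].
rewrite {}e solE.
apply: (dag_lens HK (m := ftup (fun _ => pi1 _ _))).
- by rewrite !catE.
- by apply: fpow_ext => -[]; rewrite !catE.
- apply: fpow_prod_ext => X v c; rewrite fproj_ftup !compA rename_pair GE.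
  rewrite comp_pmap comp_pmap !catE; congr (comp _ (pair _ _)).
  rewrite -[RHS]ftup_fproj; apply: eq_ftup => z.
  by rewrite /diag /fproj -compA proj_tup comp_id_l.
Qed.

Lemma Gamma_initP (Q : automaton) : (forall q : st Q, Gamma_init dag q) <-> Gamma dag Q.
Proof.
have dE A (i : 'I_#|st Q|) : comp (proj i) (diag A #|st Q|) = idm A.
  by rewrite /diag proj_tup.
split=> H; last by move=> q A C f; rewrite (H A C f) -compA dE comp_id_l.
move=> A C f; rewrite [LHS]tup_proj [RHS]tup_proj; apply: eq_tup => i.
by rewrite -compA dE comp_id_l -(H (enum_val i)) enum_valK.
Qed.

(** The identity for [d] is applied to [G] with each variable [(z', p)] replaced by
    [(phi z', p)]. *)
Lemma gam_letters (Q Z Z' : finType) (d : Q -> Z -> Q) (d' : Q -> Z' -> Q)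
    (phi : Z' -> Z) q :
  (forall q z, d' q z = d q (phi z)) -> gam d q -> gam d' q.
Proof.
move=> dd' H A C P G p.
have := H A C P
  (fun p => comp (G p) (rename (fun zp => (phi zp.1, zp.2)) A C)) p.
rewrite (eq_sol (F' := fun qp => comp (G qp.2) (rename (step d' qp) A C))).
  move=> ->; apply: eq_sol => p'.
  by rewrite compA rename_comp.
move=> [q' p']; rewrite compA rename_comp /=; congr comp.
by apply: eq_rename => -[z p'']; rewrite /step /= dd'.
Qed.

Lemma eq_gam (Q Z : finType) (d d' : Q -> Z -> Q) q :
  (forall q z, d' q z = d q z) -> gam d q -> gam d' q.
Proof. exact: gam_letters. Qed.

Lemma gam_sub (Q Q' Z : finType) (d : Q -> Z -> Q) (d' : Q' -> Z -> Q')
    (i : Q' -> Q) q :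
  injective i -> (forall q z, i (d' q z) = d (i q) z) -> gam d (i q) -> gam d' q.
Proof.
move=> i_inj di H A C P G p; rewrite -H.
rewrite (sol_sub HK (s := fun qp => (i qp.1, qp.2)) (F' := fun qp =>
  comp (G qp.2) (rename (step d' qp) A C)) (q, p)) //.
  by move=> [q1 p1] [q2 p2] [/i_inj -> ->].
move=> [q' p']; rewrite compA rename_comp; congr comp.
by apply: eq_rename => -[z p'']; rewrite /step /= di.
Qed.

(* In the product of [d] and [d'], [gam d q] makes the solution independent of
   the first component; the graph of [h] is a copy of [d] in that product. *)
Lemma gam_quotient (Q Q' Z : finType) (d : Q -> Z -> Q) (d' : Q' -> Z -> Q')
    (h : Q -> Q') q :
  (forall q z, h (d q z) = d' (h q) z) -> gam d q -> gam d' (h q).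
Proof.
move=> dh H A C P G p; rewrite -H.
have := H A C (Q' * P)%type (fun qp => comp (G qp.2)
  (rename (fun zp => (zp.1, (d' qp.1 zp.1, zp.2))) A C)) (h q, p).
rewrite (sol_sub HK (s := fun qp : Q * P => (qp.1, (h qp.1, qp.2)))
  (F' := fun qp => comp (G qp.2) (rename (step d qp) A C)) (q, p)).
- move=> ->; apply: eq_sol => -[q' p'].
  by rewrite compA rename_comp.
- by move=> [q1 p1] [q2 p2] [-> _ ->].
- move=> [q' p']; rewrite !compA !rename_comp; congr comp.
  by apply: eq_rename => -[z p'']; rewrite /step /= dh.
Qed.

(** With [Q1 * P] as parameter set, the identity for [d2] removes the second state component; the
    identity for [d1] removes the first. *)
Lemma gam_cascade (Q1 Q2 Z1 Z2 : finType) (d1 : Q1 -> Z1 -> Q1)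
    (d2 : Q2 -> Z2 -> Q2) (phi : Q1 -> Z1 -> Z2) q :
  gam d1 q.1 -> gam d2 q.2 ->
  gam (fun q z => (d1 q.1 z, d2 q.2 (phi q.1 z))) q.
Proof.
case: q => q1 q2 /= H1 H2 A C P G p; rewrite -H1.
have := H2 A C (Q1 * P)%type (fun qp => comp (G qp.2)
  (rename (fun zp => (phi qp.1 zp.1, (d1 qp.1 zp.1, zp.2))) A C)) (q1, p).
rewrite (sol_sub HK (s := fun qp : (Q1 * Q2) * P => (qp.1.2, (qp.1.1, qp.2)))
  (F' := fun qp => comp (G qp.2) (rename (step
    (fun q z => (d1 q.1 z, d2 q.2 (phi q.1 z))) qp) A C)) (q1, q2, p)).
- move=> ->; apply: eq_sol => -[q' p'].
  by rewrite compA rename_comp.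
- by move=> [[? ?] ?] [[? ?] ?] [-> -> ->].
- by move=> [[q1' q2'] p']; rewrite !compA !rename_comp.
Qed.

Lemma gam_id (Q Z : finType) (q : Q) : gam (fun q (_ : Z) => q) q.
Proof.
move=> A C P G p.
apply: (sol_sub HK (s := fun p => (q, p))) => [? ? [] //|p'].
by rewrite compA rename_comp.
Qed.

(** Auxiliary equations [x_(q, inr p) = x_(qa, inl p)] are added; unfolding the identity at
    [(q, inr p)] once turns it into the one at [qa]. *)
Lemma gam_next (Q Z : finType) (d : Q -> Z -> Q) q a :
  gam d q -> gam d (d q a).
Proof.
move=> H A C P G p.
pose G' (p : P + P) : Hom (prod (fpow (Z * (P + P))%type A) C) A :=
  match p with
  | inl p => comp (G p) (rename (fun zp => (zp.1, inl zp.2)) A C)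
  | inr p => comp (fproj (a, inl p)) (pi1 _ _)
  end.
have e := H A C _ G' (inr p).
rewrite !sol_fix //= !compA !rename_pair !catE /step /= in e.
move: e.
rewrite (sol_sub HK (s := fun qp : Q * P => (qp.1, inl qp.2))
  (F' := fun qp => comp (G qp.2) (rename (step d qp) A C)) (d q a, p)); first last.
- by move=> [q' p']; rewrite !compA !rename_comp.
- by move=> [? ?] [? ?] [-> ->].
move=> ->; apply: (sol_sub HK (s := inl)) => [? ? [] //|p'].
by rewrite !compA !rename_comp.
Qed.

(** A second letter is read through relay variables [x_(q, inr (z, p)) = x_(qz, inl p)], which
    [sol_unfold] eliminates on both sides. *)
Lemma gam_two (Q Z Z' : finType) (d : Q -> Z -> Q)
    (phi : Z' -> Z) (psi : Z' -> option Z) q :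
  gam d q ->
  gam (fun q z => oapp (d (d q (phi z))) (d q (phi z)) (psi z)) q.
Proof.
move=> H A C P G p.
pose dl (zp : Z' * P) : P + Z * P :=
  oapp (fun z => inr (z, zp.2)) (inl zp.2) (psi zp.1).
pose G' (p : P + Z * P) : Hom (prod (fpow (Z * (P + Z * P))%type A) C) A :=
  match p with
  | inl p => comp (G p) (rename (fun zp => (phi zp.1, dl zp)) A C)
  | inr zp => comp (fproj (zp.1, inl zp.2)) (pi1 _ _)
  end.
have := H A C _ G' (inl p).
pose r (qp : Q * (P + Z * P)) : Q * (P + Z * P) :=
  match qp.2 with inl p => qp | inr zp => (d qp.1 zp.1, inl zp.2) end.
rewrite (sol_unfold HK (r := r)); first last.
- move=> [q' [p'|[z p']]] /=; first by rewrite /r eqxx.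
  move=> _; apply: fpow_prod_ext => X v c.
  by rewrite !compA rename_pair !catE.
- by move=> [q' [p'|[z p']]].
rewrite (sol_sub HK (s := fun qp : Q * P => (qp.1, inl qp.2))
  (F' := fun qp => comp (G qp.2) (rename (step
     (fun q z => oapp (d (d q (phi z))) (d q (phi z)) (psi z)) qp) A C)) (q, p));
  first last.
- move=> [q' p'] /=; rewrite !compA !rename_comp; congr comp.
  apply: eq_rename => -[z p'']; rewrite /step /r /dl /=.
  by case: (psi z).
- by move=> [? ?] [? ?] [-> ->].
move=> ->.
pose r' (p : P + Z * P) : P + Z * P :=
  match p with inl _ => p | inr zp => inl zp.2 end.
rewrite (sol_unfold HK (r := r')); first last.
- move=> [p'|[z p']] /=; first by rewrite eqxx.
  move=> _; apply: fpow_prod_ext => X v c.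
  by rewrite !compA rename_pair !catE.
- by case.
apply: (sol_sub HK (s := inl)) => [? ? [] //|p'].
rewrite !compA !rename_comp; congr comp.
by apply: eq_rename => -[z p'']; rewrite /r' /dl /=; case: (psi z).
Qed.

(** Induction on a bound for the word lengths: a word of length at most [k+2] is its prefix of
    length at most [k+1] followed by at most one letter. *)
Lemma gam_words (Q Z Z' : finType) (d : Q -> Z -> Q) (w : Z' -> seq Z) q :
  (forall z, 0 < size (w z)) -> gam d q -> gam (fun q z => foldl d q (w z)) q.
Proof.
move=> w0 H.
have [k wk] : exists k, forall z, size (w z) <= k.+1.
  by exists (\max_z size (w z)) => z; apply/leqW/leq_bigmax.
elim: k Z' w w0 wk => [|k IH] Z' w w0 wk.
  have /fin_all_exists[f fE] z : exists a, w z = [:: a].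
    by have := w0 z; have := wk z; case: (w z) => [|a []] //; exists a.
  by apply: (gam_letters (phi := f)) H => q' z; rewrite fE.
(* Single letters are kept because [gam_two] draws both factors from one alphabet. *)
pose w' (z : Z + Z') : seq Z :=
  match z with inl z => [:: z] | inr z => take k.+1 (w z) end.
have {}IH : gam (fun q z => foldl d q (w' z)) q.
  apply: IH => -[z|z] //=; rewrite size_take; case: ifP => //.
  by move/negbT; rewrite -leqNgt.
have := gam_two inr (fun z => omap inl (ohead (drop k.+1 (w z)))) IH.
apply: eq_gam => q' z /=; rewrite -{1}(cat_take_drop k.+1 (w z)) foldl_cat.
have : size (drop k.+1 (w z)) <= 1 by rewrite size_drop leq_subLR addn1.
by case: (drop _ _) => [|a []].
Qed.

Lemma gam_foldl (Q Z : finType) (d : Q -> Z -> Q) q u :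
  gam d q -> gam d (foldl d q u).
Proof. by elim: u q => //= z u IH q /(gam_next z)/IH. Qed.

Definition pow_act (I Q Z : finType) (d : Q -> Z -> Q) (t : {ffun I -> Q}) z :
  {ffun I -> Q} := [ffun i => d (t i) z].

(** Coordinates are activated one at a time: each step is a cascade with a further copy of [Q],
    whose state then overwrites coordinate [i]. *)
Lemma gam_pow (I Q Z : finType) (d : Q -> Z -> Q) (t : {ffun I -> Q}) :
  (forall q, gam d q) -> gam (pow_act d) t.
Proof.
move=> H.
pose ds (s : seq I) (t : {ffun I -> Q}) z : {ffun I -> Q} :=
  [ffun i => if i \in s then d (t i) z else t i].
suff: gam (ds (enum I)) t.
  by apply: eq_gam => t' z; apply/ffunP => i; rewrite !ffunE mem_enum.
elim: (enum I) t => [|i s IH] t.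
  by apply: eq_gam (gam_id t) => t' z; apply/ffunP => i; rewrite ffunE.
pose h (tq : {ffun I -> Q} * Q) : {ffun I -> Q} :=
  [ffun j => if j == i then tq.2 else tq.1 j].
have -> : t = h (t, t i).
  by apply/ffunP => j; rewrite ffunE; case: eqP => // ->.
apply: gam_quotient (gam_cascade (fun _ z => z) (q := (t, t i)) (IH t) (H _)).
move=> [t' q] z; apply/ffunP => j; rewrite !ffunE /= inE.
by case: eqP.
Qed.

End Identities.

(** * Elimination of one letter *)

Section Step.
Variables (K : cartCat) (dag : daggerOp K) (HK : conway dag).

(* Let [c] be the letter [None]. The double dagger separates the variables
   reached by [c] from those reached by the other letters [B]. Solving the
   latter along the monoid [N] generated by [B] leaves a system over the image
   [R] of [c], in which [n] in [N] acts as the word [n c]. *)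
Lemma gam_option (Q B N R : finType) (d : Q -> option B -> Q)
    (dN : N -> B -> N) (n0 : N) (a : Q -> N -> Q)
    (dR : R -> N -> R) (i : R -> Q) (c : Q -> R) :
  (forall q, a q n0 = q) ->
  (forall q n b, a q (dN n b) = d (a q n) (Some b)) ->
  injective i -> (forall q, i (c q) = d q None) ->
  (forall r n, dR r n = c (a (i r) n)) ->
  gam dag dN n0 -> (forall r, gam dag dR r) ->
  forall q, gam dag d q.
Proof.
move=> a0 aS i_inj ic dRE HN HR q A C P G p.
(* The variables read at [c] become outer parameters, to be closed by the second dagger. *)
pose D p : Hom (prod (fpow (B * P)%type A) (prod (fpow P A) C)) A :=
  comp (G p) (pair (ftup (fun zp : option B * P =>
      match zp.1 with
      | Some b => comp (fproj (b, zp.2)) (pi1 _ _)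
      | None => comp (fproj zp.2) (comp (pi1 _ _) (pi2 _ _))
      end)) (comp (pi2 _ _) (pi2 _ _))).
have DE X (u : B * P -> Hom X A) (v : P -> Hom X A) (c' : Hom X C) p' :
    comp (D p') (pair (ftup u) (pair (ftup v) c')) =
    comp (G p') (pair (ftup (fun zp : option B * P =>
      if zp.1 is Some b then u (b, zp.2) else v zp.2)) c').
  rewrite /D !catE; congr (comp _ (pair _ _)); apply: eq_ftup => -[[b|] p''].
    by rewrite !catE.
  by rewrite !catE.
move: D DE => D DE.
pose X1 (qp : Q * P) :
    Hom (prod (fpow (Q * P)%type A) (prod (fpow (Q * P)%type A) C)) A :=
  comp (D qp.2) (pmap (ftup (fun bp => fproj (d qp.1 (Some bp.1), bp.2)))
                      (rename (fun p => (d qp.1 None, p)) A C)).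
have X1E X u v (c' : Hom X C) qp :
    comp (X1 qp) (pair (ftup u) (pair (ftup v) c')) =
    comp (G qp.2) (pair (ftup (fun zp : option B * P =>
      if zp.1 is Some b then u (d qp.1 (Some b), zp.2) else v (d qp.1 None, zp.2))) c').
  rewrite /X1 compA comp_pmap rename_pair comp_ftup DE.
  congr (comp _ (pair _ _)); apply: eq_ftup => -[[b|] p'] //=.
  by rewrite fproj_ftup.
move: X1 X1E => X1 X1E.
(* Over [N], what [c] reads at state [n] stays a free parameter [(n, p)], specialized below both to
   states of [Q] and to the stateless system. *)
pose Z1 (np : N * P) :
    Hom (prod (fpow (N * P)%type A) (prod (fpow (N * P)%type A) C)) A :=
  comp (D np.2) (pmap (ftup (fun bp => fproj (dN np.1 bp.1, bp.2)))
                      (rename (fun p => (np.1, p)) A C)).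
have Z1E X u v (c' : Hom X C) np :
    comp (Z1 np) (pair (ftup u) (pair (ftup v) c')) =
    comp (G np.2) (pair (ftup (fun zp : option B * P =>
      if zp.1 is Some b then u (dN np.1 b, zp.2) else v (np.1, zp.2))) c').
  rewrite /Z1 compA comp_pmap rename_pair comp_ftup DE.
  congr (comp _ (pair _ _)); apply: eq_ftup => -[[b|] p'] //=.
  by rewrite fproj_ftup.
move: Z1 Z1E => Z1 Z1E.
pose S (qp : Q * P) := comp (G qp.2) (rename (step d qp) A C).
pose T p := sol dag (fun p => comp (D p) (rename snd A (prod (fpow P A) C))) p.
pose t p := sol dag (fun p => comp (G p) (rename snd A C)) p.
have solS : sol dag S =1 sol dag (sol dag X1).
  move=> qp; rewrite sol_double //; apply: eq_sol => qp'.
  apply: fpow_prod_ext => X v c'; rewrite /S !sysE X1E.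
  by congr (comp _ (pair _ _)); apply: eq_ftup => -[[b|] p'].
have solT : sol dag T =1 t.
  move=> p'; rewrite /T /t sol_double //; apply: eq_sol => p''.
  apply: fpow_prod_ext => X v c'; rewrite !sysE DE.
  by congr (comp _ (pair _ _)); apply: eq_ftup => -[[b|] p3].
(* The map [n |-> a q' n] respects the letters of [B]; as for quotients, its graph is a copy of [N]
   in the product with [Q]. *)
have X1_Z1 q' p' : sol dag X1 (q', p') =
    comp (sol dag Z1 (n0, p')) (rename (fun np => (i (c (a q' np.1)), np.2)) A C).
  pose G1 (qp : Q * P) :
      Hom (prod (fpow (B * (Q * P))%type A) (prod (fpow (Q * P)%type A) C)) A :=
    comp (D qp.2) (pmap (ftup (fun bp => fproj (bp.1, (d qp.1 (Some bp.1), bp.2))))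
                        (rename (fun p => (d qp.1 None, p)) A C)).
  have G1E X u v (c' : Hom X C) qp :
      comp (G1 qp) (pair (ftup u) (pair (ftup v) c')) =
      comp (G qp.2) (pair (ftup (fun zp : option B * P =>
        if zp.1 is Some b then u (b, (d qp.1 (Some b), zp.2))
        else v (d qp.1 None, zp.2))) c').
    rewrite /G1 compA comp_pmap rename_pair comp_ftup DE.
    congr (comp _ (pair _ _)); apply: eq_ftup => -[[b|] p2] //=.
    by rewrite fproj_ftup.
  move: G1 G1E => G1 G1E.
  have -> : sol dag X1 (q', p') =
      sol dag (fun qp => comp (G1 qp) (rename snd A _)) (q', p').
    apply: eq_sol => qp; apply: fpow_prod_ext => X u c'.
    rewrite -[c']comp_id_l -pair_pi comp_pair -[comp (pi1 _ _) _]ftup_fproj.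
    by rewrite compA rename_pair X1E G1E.
  rewrite -HN -sol_param //.
  rewrite -[in LHS](a0 q').
  apply: (sol_sub HK (s := fun np : N * P => (np.1, (a q' np.1, np.2))) (n0, p')).
    by move=> [? ?] [? ?] [-> _ ->].
  move=> [n p2]; apply: fpow_prod_ext => X u c'.
  rewrite -[c']comp_id_l -pair_pi comp_pair -[comp (pi1 _ _) _]ftup_fproj.
  rewrite !compA !rename_pair comp_pmap comp_id_l rename_pair G1E Z1E /=.
  congr (comp _ (pair _ _)); apply: eq_ftup => -[[b|] p3] /=.
    by rewrite /step /= aS.
  by rewrite ic.
have Z1_T p' : comp (sol dag Z1 (n0, p')) (rename snd A C) = T p'.
  rewrite /T -HN -sol_param //; apply: eq_sol => np.
  apply: fpow_prod_ext => X u c'.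
  rewrite -[c']comp_id_l -pair_pi comp_pair -[comp (pi1 _ _) _]ftup_fproj.
  rewrite !compA comp_pmap comp_id_l !rename_pair Z1E DE.
  by congr (comp _ (pair _ _)); apply: eq_ftup => -[[b|] p3] /=.
(* On the image of [i] the outer system is closed: its right-hand sides are those of [sol dag Z1] at
   [n0], with alphabet [N] and action [dR]. *)
have solR r p' : sol dag S (i r, p') = t p'.
  rewrite solS -solT -(eq_sol Z1_T) -(HR r).
  apply: (sol_sub HK (s := fun rp : R * P => (i rp.1, rp.2)) (r, p')).
    by move=> [? ?] [? ?] [/i_inj -> ->].
  move=> [r' p2]; rewrite X1_Z1 compA rename_comp; congr comp.
  by apply: eq_rename => -[n p3]; rewrite /step /= dRE.
(* Unfolded once, the outer equation of any [q] reads only states in the image of [i], where [solR]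
   applies. *)
rewrite -/(S) -/(t p) solS sol_fix // X1_Z1 compA rename_pair.
rewrite -solT [RHS]sol_fix // -Z1_T compA rename_pair.
congr (comp _ (pair _ _)); apply: eq_ftup => np /=.
by rewrite -solS solR solT.
Qed.

End Step.

(** * Transformation monoids and division by groups *)

Section Division.

Definition acc (Q Z : finType) (d : Q -> Z -> Q) : rel Q :=
  connect [rel x y | [exists z, y == d x z]].

Lemma acc_step (Q Z : finType) (d : Q -> Z -> Q) q q' z :
  acc d q q' -> acc d q (d q' z).
Proof.
by move/connect_trans; apply; apply: connect1; apply/existsP; exists z.
Qed.

Lemma accP (Q Z : finType) (d : Q -> Z -> Q) q q' :
  reflect (exists u, q' = foldl d q u) (acc d q q').
Proof.
apply: (iffP idP) => [/connectP[s]|[u ->]].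
  elim: s q => [|x s IH] q /=; first by move=> _ ->; exists [::].
  case/andP=> /existsP[z /eqP->] /IH H /H[u ->]; by exists (z :: u).
elim/last_ind: u => [|u z IH]; first exact: connect0.
by rewrite foldl_rcons acc_step.
Qed.

Definition fid (Q : finType) : {ffun Q -> Q} := [ffun q => q].

Definition fthen (Q : finType) (f g : {ffun Q -> Q}) : {ffun Q -> Q} :=
  [ffun q => g (f q)].

(** Membership in the monoid of [d], as reachability from the identity: being boolean, it makes that
    monoid a finite type. *)
Definition induced (Q Z : finType) (d : Q -> Z -> Q) (f : {ffun Q -> Q}) :=
  acc (pow_act d) (fid Q) f.

Lemma inducedP (Q Z : finType) (d : Q -> Z -> Q) (f : {ffun Q -> Q}) :
  reflect (exists u, forall q, f q = foldl d q u) (induced d f).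
Proof.
have E u (t : {ffun Q -> Q}) q : foldl (pow_act d) t u q = foldl d (t q) u.
  by elim: u t => //= z u IH t; rewrite IH ffunE.
apply: (iffP (accP _ _ _)) => -[u fu]; exists u.
  by move=> q; rewrite fu E ffunE.
by apply/ffunP => q; rewrite fu E ffunE.
Qed.

Lemma induced_fthen (Q Z : finType) (d : Q -> Z -> Q) f g :
  induced d f -> induced d g -> induced d (fthen f g).
Proof.
move=> /inducedP[u fu] /inducedP[v gv]; apply/inducedP; exists (u ++ v) => q.
by rewrite ffunE gv fu foldl_cat.
Qed.

(* The group [G] is a quotient, along a functional relation, of a subsemigroup
   of the monoid of [d]. *)
Definition sdiv (G : finGroupType) (Q Z : finType) (d : Q -> Z -> Q) : Prop :=
  exists R : {ffun Q -> Q} -> G -> bool,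
    [/\ forall f g, R f g -> induced d f,
        forall f g f' g', R f g -> R f' g' -> R (fthen f f') (g * g')%g,
        forall f g g', R f g -> R f g' -> g = g' &
        forall g, exists f, R f g].

(* A minimal subsemigroup [S] still mapping onto [G] is a group, because
   [x S] and [S x] map onto [G] as well. *)
Lemma sdiv_divides_monoid (G : finGroupType) (Q : automaton) :
  sdiv G (@act Q) -> divides_monoid G Q.
Proof.
case=> R [Rind Rmul Rfun Rtot].
pose good (S : {set {ffun st Q -> st Q}}) :=
  [&& [forall x in S, forall y in S, Mmul x y \in S],
      [forall x in S, exists g, R x g] & [forall g, exists x in S, R x g]].
have goodP (S : {set {ffun st Q -> st Q}}) : reflect
    [/\ {in S &, forall x y, Mmul x y \in S}, {in S, forall x, exists g, R x g} &
        forall g, exists2 x, x \in S & R x g] (good S).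
  apply: (iffP and3P) => [[H1 H2 H3]|[H1 H2 H3]].
    split=> [x y Sx Sy|x Sx|g].
    - exact: (forall_inP (forall_inP H1 x Sx) y Sy).
    - exact: (existsP (forall_inP H2 x Sx)).
    - exact: (exists_inP (forallP H3 g)).
  split.
  - by apply/forall_inP => x Sx; apply/forall_inP => y; apply: H1.
  - by apply/forall_inP => x Sx; apply/existsP/H2.
  - by apply/forallP => g; apply/exists_inP.
have good0 : good [set f | [exists g, R f g]].
  apply/goodP; split=> [x y|x|g]; rewrite ?inE.
  - move=> /existsP[g Rx] /existsP[g' Ry]; apply/existsP; exists (g * g')%g.
    exact: Rmul.
  - by move/existsP.
  - have [x Rx] := Rtot g; exists x => //.
    by rewrite inE; apply/existsP; exists g.
have [S /minsetP[/goodP[SM SR St] Smin] _] := minset_exists good0.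
have mulA (x y z : {ffun st Q -> st Q}) : Mmul x (Mmul y z) = Mmul (Mmul x y) z.
  by apply/ffunP => q; rewrite !ffunE.
have SL x : x \in S -> Mmul x @: S = S.
  move=> Sx; have [gx Rx] := SR _ Sx; apply: Smin; last first.
    by apply/subsetP => _ /imsetP[y Sy ->]; apply: SM.
  apply/goodP; split.
  - move=> _ _ /imsetP[y Sy ->] /imsetP[z Sz ->].
    by rewrite -mulA; apply: imset_f; rewrite !SM.
  - by move=> _ /imsetP[y Sy ->]; apply: SR; apply: SM.
  - move=> g; have [y Sy Ry] := St (gx^-1 * g)%g.
    exists (Mmul x y); first exact: imset_f.
    by have := Rmul _ _ _ _ Rx Ry; rewrite mulKVg.
have Sr x : x \in S -> [set Mmul y x | y in S] = S.
  move=> Sx; have [gx Rx] := SR _ Sx; apply: Smin; last first.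
    by apply/subsetP => _ /imsetP[y Sy ->]; apply: SM.
  apply/goodP; split.
  - move=> _ _ /imsetP[y Sy ->] /imsetP[z Sz ->].
    by rewrite mulA; apply/imsetP; exists (Mmul (Mmul y x) z); rewrite ?SM.
  - by move=> _ /imsetP[y Sy ->]; apply: SR; apply: SM.
  - move=> g; have [y Sy Ry] := St (g * gx^-1)%g.
    exists (Mmul y x); first by apply/imsetP; exists y.
    by have := Rmul _ _ _ _ Ry Rx; rewrite mulgKV.
(* Any [s] serves: since [S s = S], an [e] with [s = s e] is a right identity of [S]; dually on the
   left. *)
have [s Ss _] := St 1%g.
have [e Se se] : exists2 e, e \in S & s = Mmul s e.
  by have := Ss; rewrite -{1}(SL _ Ss) => /imsetP.
have xe x : x \in S -> Mmul x e = x.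
  by rewrite -(Sr _ Ss) => /imsetP[y Sy ->]; rewrite -mulA -se.
have [e' Se' se'] : exists2 e', e' \in S & s = Mmul e' s.
  by have := Ss; rewrite -{1}(Sr _ Ss) => /imsetP.
have e'x x : x \in S -> Mmul e' x = x.
  by rewrite -(SL _ Ss) => /imsetP[y Sy ->]; rewrite mulA -se'.
have ee' : e' = e by rewrite -(xe _ Se') e'x.
have ex x : x \in S -> Mmul e x = x by rewrite -ee'; apply: e'x.
(* The default is taken only outside the domain of [R], hence never on [S]. *)
pose phi x := if [pick g | R x g] is Some g then g else 1%g.
have phiP x g : R x g -> phi x = g.
  rewrite /phi; case: pickP => [g' Rg' Rg|/(_ g) -> //]; exact: Rfun Rg' Rg.
exists S, e; split=> //.
- by move=> x /SR[g /Rind/inducedP].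
- by move=> x Sx; rewrite ex ?xe.
- move=> x Sx.
  have [y Sy xy] : exists2 y, y \in S & e = Mmul x y.
    by have := Se; rewrite -{1}(SL _ Sx) => /imsetP.
  have [z Sz zx] : exists2 z, z \in S & e = Mmul z x.
    by have := Se; rewrite -{1}(Sr _ Sx) => /imsetP.
  exists y => //; split=> //.
  have <- : z = y by rewrite -[LHS]xe // xy mulA -zx ex.
  by [].
- exists phi; split=> [x y Sx Sy|g].
    have [g Rx] := SR _ Sx; have [g' Ry] := SR _ Sy.
    by rewrite (phiP _ _ Rx) (phiP _ _ Ry); apply: phiP; apply: Rmul.
  by have [x Sx /phiP] := St g; exists x.
Qed.

(** [G] is a quotient of a subgroup of [P]: the domain of [R] is closed under products, hence a
    subgroup by finiteness. *)
Definition gsec (G P : finGroupType) : Prop :=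
  exists R : P -> G -> bool,
    [/\ forall x g x' g', R x g -> R x' g' -> R (x * x')%g (g * g')%g,
        forall x g g', R x g -> R x g' -> g = g' &
        forall g, exists x, R x g].

Lemma gsec_refl (G : finGroupType) : gsec G G.
Proof.
exists (fun x y => x == y); split.
- by move=> x g x' g' /eqP -> /eqP ->.
- by move=> x g g' /eqP -> /eqP.
- by move=> g; exists g.
Qed.

Lemma gsec_subg (G P : finGroupType) (N : {group P}) :
  gsec G (subg_of N) -> gsec G P.
Proof.
case=> R [Rmul Rfun Rtot].
exists (fun x g => [exists n : subg_of N, (x == sgval n) && R n g]); split.
- move=> x g x' g' /existsP[n /andP[/eqP -> Rn]] /existsP[n' /andP[/eqP -> Rn']].
  by apply/existsP; exists (n * n')%g; rewrite Rmul ?morphM ?inE ?eqxx.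
- move=> x g g' /existsP[n /andP[/eqP -> Rn]] /existsP[n' /andP[/eqP/subg_inj <-]].
  exact: Rfun.
- move=> g; have [n Rn] := Rtot g; exists (sgval n).
  by apply/existsP; exists n; rewrite eqxx.
Qed.

Lemma gsec_coset (G P : finGroupType) (N : {group P}) :
  (N <| [set: P])%g -> gsec G (coset_of N) -> gsec G P.
Proof.
move=> /andP[_ nN] [R [Rmul Rfun Rtot]].
have inN x : x \in 'N(N)%g by rewrite (subsetP nN) ?inE.
exists (fun x g => R (coset N x) g); split.
- by move=> x g x' g'; rewrite morphM //; apply: Rmul.
- by move=> x; apply: Rfun.
- by move=> g; have [x Rx] := Rtot g; exists (repr x); rewrite coset_reprK.
Qed.

End Division.

(** * Group identities and composition factors *)

Section Groups.
Variables (K : cartCat) (dag : daggerOp K) (HK : conway dag).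

Definition gamG (G : finGroupType) : Prop :=
  forall q : G, gam dag (fun x y : G => x * y)%g q.

(** [P] is the image, under [(x, n) |-> n * repr x], of the cascade of the quotient with [N] driven
    by the Schreier cocycle [phi]. *)
Lemma gamG_extension (P : finGroupType) (N : {group P}) :
  (N <| [set: P])%g -> gamG (subg_of N) -> gamG (coset_of N) -> gamG P.
Proof.
move=> /andP[_ nN] HN HQ p.
have inN x : x \in 'N(N)%g by rewrite (subsetP nN) ?inE.
have repN x : (x * (repr (coset N x))^-1)%g \in N.
  apply: coset_idr => //; rewrite morphM ?morphV ?inN //= coset_reprK.
  exact: mulgV.
pose phi (x : coset_of N) (y : P) : subg_of N :=
  subg N (repr x * y * (repr (x * coset N y)%g)^-1)%g.
have phiE x y : sgval (phi x y) = (repr x * y * (repr (x * coset N y)%g)^-1)%g.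
  rewrite /phi subgK //.
  have cxy : coset N (repr x * y)%g = (x * coset N y)%g.
    by rewrite morphM ?inN //= coset_reprK.
  by rewrite -cxy; apply: repN.
pose h (xn : coset_of N * subg_of N) : P := (sgval xn.2 * repr xn.1)%g.
pose xn : coset_of N * subg_of N := (coset N p, subg N (p * (repr (coset N p))^-1)%g).
have -> : p = h xn by rewrite /h /= subgK // mulgKV.
apply: (gam_quotient HK (d := fun q y =>
  ((q.1 * coset N y)%g, (q.2 * phi q.1 y)%g))).
  move=> [x n] y; rewrite /h [sgval _]sgvalM ?inE // phiE.
  by rewrite !mulgA mulgKV.
apply: (gam_cascade HK (d1 := fun x y => (x * coset N y)%g) phi) => //=.
exact: gam_letters (HQ _).
Qed.

(** Induction on the order: simple sections of a normal subgroup or of its quotient are sections of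
    [P]. *)
Lemma gamG_of_simple (P : finGroupType) :
  (forall G : finGroupType, simple [set: G] -> gsec G P -> gamG G) -> gamG P.
Proof.
have [k] := ubnP #|P|; elim: k P => // k IH P Pk HP.
have [P1|P1] := boolP ([set: P] == 1%g).
  move=> p; apply: eq_gam (gam_id HK p) => x y.
  have E (z : P) : z = 1%g by apply/set1gP; rewrite -(eqP P1) inE.
  by rewrite [LHS]E [RHS]E.
have [/existsP[N /and3P[nN N1 NT]]|/existsPn nsN] := boolP
  [exists N : {group P}, [&& (N <| [set: P])%g, N :!=: 1%g & N :!=: [set: P]]].
  have cN : #|subg_of N| < #|P|.
    rewrite -(card_imset predT (@subg_inj _ N)) -cardsT.
    apply: (@leq_ltn_trans #|N|); last first.
      by rewrite proper_card // properEneq NT subsetT.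
    by apply: subset_leq_card; apply/subsetP => _ /imsetP[n _ ->]; apply: subgP.
  have cQ : #|{: coset_of N}| < #|P|.
    rewrite -[#|P|]cardsT; apply: leq_ltn_trans (ltn_quotient N1 (subsetT N)).
    apply: subset_leq_card; apply/subsetP => x _.
    by rewrite -(coset_reprK x) mem_quotient ?inE.
  apply: (gamG_extension nN); apply: IH.
  - exact: leq_trans cN _.
  - by move=> G sG /gsec_subg; apply: HP.
  - exact: leq_trans cQ _.
  - by move=> G sG /(gsec_coset nN); apply: HP.
apply: HP (gsec_refl P); apply/simpleP; split=> // N nN.
have := nsN N; rewrite nN /= negb_and !negbK.
by case/orP => /eqP; [left | right].
Qed.

End Groups.

(** * Reduction of automata to simple groups *)

Section Decomposition.
Variables (K : cartCat) (dag : daggerOp K) (HK : conway dag).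

(** Evaluation at [q] maps the group [W] generated by the letters, acting on itself by right
    multiplication, onto the orbit of [q]. *)
Lemma gam_permutations (Q Z : finType) (d : Q -> Z -> Q) :
  (forall z, injective (d^~ z)) ->
  (forall G : finGroupType, simple [set: G] -> sdiv G d -> gamG dag G) ->
  forall q, gam dag d q.
Proof.
move=> d_inj HG q.
pose pz z := perm (d_inj z).
pose W := <<[set pz z | z : Z]>>%G.
have pzW z : pz z \in W by apply: mem_gen; apply: imset_f.
have Wind (x : subg_of W) : induced d [ffun q => sgval x q].
  (* By finiteness, products of generators without inverses exhaust [W]. *)
  have /gen_prodgP[n [c cZ ->]] := subgP x; apply/inducedP.
  elim: n c cZ => [|n IH] c cZ.
    by exists [::] => q'; rewrite big_ord0 ffunE perm1.
  have [u Hu] := IH (fun i => c (widen_ord (leqnSn n) i)) (fun i => cZ _).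
  have /imsetP[z _ cz] := cZ ord_max.
  exists (rcons u z) => q'; have := Hu q'.
  by rewrite !ffunE big_ord_recr /= cz foldl_rcons permM permE => ->.
have HW : gamG dag (subg_of W).
  apply: (gamG_of_simple HK) => G sG [R [Rmul Rfun Rtot]]; apply: HG => //.
  exists (fun f g => [exists x : subg_of W, (f == [ffun q => sgval x q]) && R x g]).
  split.
  - by move=> f g /existsP[x /andP[/eqP-> _]]; apply: Wind.
  - move=> f g f' g' /existsP[x /andP[/eqP-> Rx]] /existsP[x' /andP[/eqP-> Rx']].
    apply/existsP; exists (x * x')%g; rewrite Rmul // andbT.
    by apply/eqP/ffunP => q'; rewrite !ffunE [sgval (x * x')%g]sgvalM ?inE // permM.
  - move=> f g g' /existsP[x /andP[/eqP-> Rx]] /existsP[x' /andP[/eqP/ffunP xx' Rx']].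
    apply: Rfun Rx _; suff -> : x = x' by [].
    by apply/subg_inj/permP => q'; have := xx' q'; rewrite !ffunE.
  - move=> g; have [x Rx] := Rtot g; exists [ffun q => sgval x q].
    by apply/existsP; exists x; rewrite eqxx.
have -> : q = sgval (1%g : subg_of W) q by rewrite morph1 perm1.
apply: (gam_quotient HK (d := fun x z => (x * subg W (pz z))%g)
  (h := fun x : subg_of W => sgval x q)).
  by move=> x z; rewrite [sgval _]sgvalM ?inE // subgK // permM permE.
exact: gam_letters (HW _).
Qed.

(** Lexicographic induction, first on states, then on letters: deleting [c] keeps the states, while
    the smaller state set [R] comes with the possibly larger alphabet [N]. *)
Lemma gam_of_simple (Q Z : finType) (d : Q -> Z -> Q) :
  (forall G : finGroupType, simple [set: G] -> sdiv G d -> gamG dag G) ->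
  forall q, gam dag d q.
Proof.
have [n] := ubnP #|Q|; have [m] := ubnP #|Z|.
elim: n m Q Z d => // n IHn; elim=> // m IHm Q Z d Zm Qn HG q.
have [/forallP d_inj|] := boolP [forall z, injectiveb (d^~ z)].
  by apply: gam_permutations => // z; apply/injectiveP.
rewrite negb_forall => /existsP[c c_inj].
pose B := {z | z != c}.
pose dB (q : Q) (b : B) := d q (val b).
have dB_ind t : induced dB t -> induced d t.
  move=> /inducedP[u fu]; apply/inducedP; exists (map val u) => q'.
  by rewrite fu; elim: u q' {fu} => //= b u IH q'; rewrite IH.
have HB : forall q, gam dag dB q.
  apply: IHm => //.
    rewrite card_sig; move: Zm; rewrite ltnS; apply: leq_trans.
    apply: proper_card; apply/properP; split; first exact/subsetP.
    by exists c; rewrite ?inE ?eqxx.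
  move=> G sG [R [Rind Rmul Rfun Rtot]]; apply: HG => //; exists R; split=> //.
  by move=> f g /Rind/dB_ind.
pose N := {t | induced dB t}.
have N_ind (t : N) : induced d (val t) := dB_ind _ (valP t).
pose n0 : N := exist _ (fid Q) (connect0 _ _).
pose dN (t : N) (b : B) : N :=
  exist _ (pow_act dB (val t) b) (acc_step b (valP t)).
pose R : finType := {q | q \in codom (d^~ c)}.
pose cR q : R := exist _ (d q c) (codom_f (d^~ c) q).
pose a q (t : N) := val t q.
pose dR (r : R) (t : N) := cR (a (val r) t).
apply: (gam_letters (d := fun q z => d q (oapp val c z))
    (phi := fun z => insub z : option B)).
  by move=> q' z; case: (insubP _ z) => [b _ <- //|]; rewrite negbK => /eqP ->.
apply: (gam_option HK (dN := dN) (n0 := n0) (a := a) (dR := dR) (i := val) (c := cR)).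
- by move=> q'; rewrite /a /= ffunE.
- by move=> q' t b; rewrite /a /= ffunE.
- exact: val_inj.
- by [].
- by [].
- apply: (gam_sub HK (d := pow_act dB) (i := val)) => //; first exact: val_inj.
  exact: gam_pow.
apply: IHn (ltnSn _) _ _.
  rewrite card_sig; move: Qn; rewrite ltnS; apply: leq_trans.
  rewrite ltn_neqAle leq_image_card andbT.
  apply: contraNneq c_inj => /eqP/image_injP inj_c.
  by apply/injectiveP => x y; apply: inj_c.
move=> G sG [S [Sind Smul Sfun Stot]]; apply: HG => //.
(* Groups dividing the monoid of [dR] divide that of [d]: a word of [dR] lifts to a word of [d],
   related to [g] through its restriction [v] to [R]. *)
pose ext (w : {ffun Q -> Q}) (v : {ffun R -> R}) := [forall r, w (val r) == val (v r)].
have extP (w : {ffun Q -> Q}) (v : {ffun R -> R}) :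
    reflect (forall r, w (val r) = val (v r)) (ext w v).
  exact: 'forall_eqP.
exists (fun w g => induced d w && [exists v, ext w v && S v g]); split.
- by move=> w g /andP[].
- move=> w g w' g' /andP[iw /existsP[v /andP[/extP wv Sv]]].
  move=> /andP[iw' /existsP[v' /andP[/extP wv' Sv']]].
  rewrite induced_fthen //=; apply/existsP; exists (fthen v v').
  rewrite Smul // andbT; apply/extP => r.
  by rewrite !ffunE wv wv'.
- move=> w g g' /andP[_ /existsP[v /andP[/extP wv Sv]]].
  move=> /andP[_ /existsP[v' /andP[/extP wv' Sv']]].
  apply: Sfun Sv _; suff -> : v = v' by [].
  by apply/ffunP => r; apply: val_inj; rewrite -wv wv'.
- move=> g; have [v Sv] := Stot g.
  suff [w iw wv] : exists2 w, induced d w & ext w v.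
    by exists w; rewrite iw; apply/existsP; exists v; rewrite wv.
  have /inducedP[u vu] := Sind _ _ Sv.
  suff [w iw wu] : exists2 w : {ffun Q -> Q}, induced d w &
      forall r, w (val r) = val (foldl dR r u).
    by exists w => //; apply/extP => r; rewrite wu vu.
  elim/last_ind: u {vu} => [|u t [w iw wu]].
    exists (fid Q); first exact: connect0.
    by move=> r; rewrite ffunE.
  (* The letter [t] of [dR] lifts to a word for [t] followed by [c]. *)
  exists (pow_act d (fthen w (val t)) c).
    by apply: acc_step; apply: induced_fthen.
  by move=> r; rewrite foldl_rcons !ffunE wu.
Qed.

Lemma Gamma_group_gamG (G : finGroupType) : Gamma_group dag G <-> gamG dag G.
Proof.
split=> [/Gamma_initP H q|H]; first exact: (Gamma_init_gam HK (H q)).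
by apply/Gamma_initP => q; apply: (gam_Gamma_init HK); apply: H.
Qed.

(* The elements of the group act on the functions [Q -> Q] by composition;
   nontriviality of [G] lets us represent them by nonempty words. *)
Lemma gamG_of_divides (Q : automaton) (G : finGroupType) :
  simple [set: G] -> divides_monoid G Q -> (forall q, gam dag (@act Q) q) ->
  gamG dag G.
Proof.
move=> /simpleP[G1 _] [H [_ [HM [Hmul _] _ _ [phi [phiM phi_onto]]]]] HQ.
(* The empty word would make [x] idempotent, forcing [phi x = 1]. *)
have ne_word x u : x \in H -> phi x != 1%g -> (forall q, x q = actw q u) -> 0 < size u.
  move=> Hx; case: u => // + xu.
  have xx : Mmul x x = x by apply/ffunP => q; rewrite ffunE !xu.
  by have := phiM _ _ Hx Hx; rewrite xx -{1}[phi x]mulg1 => /mulgI <-; rewrite eqxx.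
have [g0 g01] : exists g : G, g != 1%g.
  have /trivgPn[g _ g1] : [set: G] != 1%g by [].
  by exists g.
have word g : exists xu : {ffun st Q -> st Q} * seq (al Q),
    [/\ xu.1 \in H, phi xu.1 = g, 0 < size xu.2 & forall q, xu.1 q = actw q xu.2].
  have [->{g}|g1] := eqVneq g 1%g.
    (* A preimage of [1] with a nonempty word comes from preimages of [g0] and its inverse. *)
    have [x Hx px] := phi_onto g0; have [y Hy py] := phi_onto g0^-1%g.
    have [u xu] := HM _ Hx; have [v yv] := HM _ Hy.
    exists (Mmul x y, u ++ v); split=> /=; first exact: Hmul.
    - by rewrite phiM // px py mulgV.
    - by rewrite size_cat addn_gt0 (ne_word x) // px.
    - by move=> q; rewrite ffunE yv xu /actw foldl_cat.
  have [x Hx px] := phi_onto g; have [u xu] := HM _ Hx.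
  by exists (x, u); split=> //=; apply: ne_word xu; rewrite // px.
have [f fP] := fin_all_exists word.
(* Right multiplication by the chosen preimages makes [H] a subautomaton of a power of the word
   automaton, and [phi] maps it onto [G]. *)
pose T := {x | x \in H}.
have dT_proof (x : T) g : Mmul (val x) (f g).1 \in H.
  by apply: Hmul (valP x) _; case: (fP g).
pose dT (x : T) g : T := exist _ (Mmul (val x) (f g).1) (dT_proof x g).
move=> g; have [x Hx <-] := phi_onto g.
apply: (gam_quotient HK (d := dT) (h := fun x : T => phi (val x)) (q := exist _ x Hx)).
  by move=> y g'; case: (fP g') => Hf pf _ _ /=; rewrite phiM ?pf ?(valP y).
apply: (gam_sub HK (d := pow_act (fun q g => foldl (@act Q) q (f g).2)) (i := val)).
- exact: val_inj.
- move=> y g'; apply/ffunP => q; rewrite !ffunE.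
  by case: (fP g') => _ _ _ ->.
apply: gam_pow => // q; apply: gam_words => // g'.
by case: (fP g').
Qed.

End Decomposition.

Theorem theorem5p2
  (Qs : init_automaton -> Prop)
  (HQs : forall Qq, Qs Qq -> initially_connected Qq)
  (K : cartCat) (dag : daggerOp K) (HK : conway dag) :
  (forall Qq, Qs Qq -> Gamma_init dag (projT2 Qq)) <->
  (forall G : finGroupType,
      simple [set: G] ->
      (exists Qq, Qs Qq /\ divides_monoid G (projT1 Qq)) ->
      Gamma_group dag G).
Proof.
split=> [HG G sG [[Q q] [QsQ divG]]|HG [Q q] QsQ].
  (* Initial connectedness carries the identity from [q] to every state, as [gamG_of_divides]
     requires. *)
  apply/(Gamma_group_gamG HK); apply: (gamG_of_divides HK sG divG) => q'.
  have [u ->] := HQs _ QsQ q'; apply: gam_foldl => //.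
  exact: (Gamma_init_gam HK (HG _ QsQ)).
apply: (gam_Gamma_init HK); apply: (gam_of_simple HK) => G sG divG.
apply/(Gamma_group_gamG HK); apply: HG => //.
by exists (existT _ Q q); split=> //; apply: sdiv_divides_monoid.
Qed.
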